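(* Let $m$ be a nonzero integer. For any $h\in H(\mathbb{R})$ and any $F\in L^2(H(\mathbb{Z})\backslash H(\mathbb{R}),d\mu)$, $$\rho_h\circ T_m(F)(a,c,z)=T_m\circ\rho_{\beta(m)h}(F)(a,c,z)$$ and $$\rho_h\circ T_m^{*}(F)(a,c,z)=T_m^{*}\circ\rho_{\beta(1/m)h}(F)(a,c,z).$$
   Context: $H(\mathbb{R})$ is the real Heisenberg group of triples $[a,c,z]\in\mathbb{R}^3$ with law $[a,c,z]\circ[a',c',z']=[a+a',c+c',z+z'+ca']$ and Haar measure $d\mu=da\,dc\,dz$; $H(\mathbb{Z})$ is the subgroup of integer triples. $\mathcal{H}=L^2(H(\mathbb{Z})\backslash H(\mathbb{R}),d\mu)$ is the Hilbert space of left $H(\mathbb{Z})$-invariant functions on $H(\mathbb{R})$ that are square-integrable over $[0,1]^3$ (with the corresponding inner product). $H(\mathbb{R})$ acts on it by $\rho_h(F)(g)=F(gh)$. For $t\in\mathbb{R}^*$, $\beta(t)$ is the automorphism $\beta(t)[a,c,z]=[\frac1t a,tc,z]$ of $H(\mathbb{R})$. For a nonzero integer $m$, $T_m$ is the bounded operator on $\mathcal{H}$ given by $T_m(F)(a,c,z)=\frac1{|m|}\sum_{j=0}^{|m|-1}F(\frac{a+j}{m},mc,z)$, and $T_m^{*}$ is its Hilbert space adjoint on $\mathcal{H}$. *)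

(* Defs.v *)
From HB Require Import structures.
From mathcomp Require Import all_boot all_order all_algebra.
From mathcomp Require Import complex.
From mathcomp Require Import all_classical all_reals all_analysis.

Set Implicit Arguments.
Unset Strict Implicit.
Unset Printing Implicit Defensive.

Import Order.TTheory GRing.Theory Num.Theory.
Import numFieldNormedType.Exports.

Local Open Scope classical_set_scope.
Local Open Scope ring_scope.

(* [a, c, z] is the triple ((a, c), z), so that the product measurable
   structure and the product measure of the library apply; [measurableTypeR R]
   is R with its Borel sigma-algebra, on which [lebesgue_measure] lives. *)
Notation heis R :=
  (measurableTypeR R * measurableTypeR R * measurableTypeR R)%type.

Section Heisenberg.
Context {R : realType}.

Definition hmul (g h : heis R) : heis R :=
  let: (a, c, z) := g in let: (a', c', z') := h in
  (a + a', c + c', z + z' + c * a').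

Definition heisZ : set (heis R) :=
  [set g | exists k l n : int, g = (k%:~R, l%:~R, n%:~R)].

Definition haar : {measure set (heis R) -> \bar R} :=
  ((lebesgue_measure \x lebesgue_measure) \x lebesgue_measure)%E.

Definition unit_cube : set (heis R) :=
  (`[0, 1]%classic `*` `[0, 1]%classic) `*` `[0, 1]%classic.

Definition beta (t : R) (g : heis R) : heis R :=
  let: (a, c, z) := g in (t^-1 * a, t * c, z).

(* The library has no sigma-algebra on R[i]; measurability of both components
   is Borel measurability for the identification of R[i] with R * R. *)
Definition cmeasurable (F : heis R -> R[i]) : Prop :=
  measurable_fun setT (fun g => complex.Re (F g)) /\
  measurable_fun setT (fun g => complex.Im (F g)).

Definition cintegral (D : set (heis R)) (F : heis R -> R[i]) : R[i] :=
  Complex (\int[haar]_(g in D) complex.Re (F g))%R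
          (\int[haar]_(g in D) complex.Im (F g))%R.

(* The Hilbert space L^2(H(Z)\H(R)) is the set [L2H] of representatives,
   taken up to equality [haar]-almost everywhere. *)
Definition L2H : set (heis R -> R[i]) :=
  [set F | [/\ cmeasurable F,
               forall gamma g, heisZ gamma -> F (hmul gamma g) = F g
             & (\int[haar]_(g in unit_cube)
                  ((Normc.normc (F g)) ^+ 2)%:E < +oo)%E]].

Definition L2H_inner (F G : heis R -> R[i]) : R[i] :=
  cintegral unit_cube (fun g => F g * conjc (G g)).

Definition rho (h : heis R) (F : heis R -> R[i]) : heis R -> R[i] :=
  fun g => F (hmul g h).

Definition Tm (m : int) (F : heis R -> R[i]) : heis R -> R[i] :=
  fun g => let: (a, c, z) := g in
  (`|m|%N%:R)^-1 *
  \sum_(0 <= j < `|m|%N) F ((a + j%:R) / m%:~R, m%:~R * c, z).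

(* [S] represents the Hilbert space adjoint of [T] on L^2(H(Z)\H(R)).  The
   identity determines [S F] up to equality almost everywhere. *)
Definition is_adjoint (T S : (heis R -> R[i]) -> (heis R -> R[i])) : Prop :=
  (forall F, L2H F -> L2H (S F)) /\
  (forall F G, L2H F -> L2H G -> L2H_inner (T F) G = L2H_inner F (S G)).

End Heisenberg.

(* Main.v *)
From HB Require Import structures.
Require Import Defs.
From mathcomp Require Import all_boot all_order all_algebra.
From mathcomp Require Import complex.
From mathcomp Require Import all_classical all_reals all_analysis.
From mathcomp Require Import measurable_realfun.
From mathcomp Require Import ring lra.

Import Order.TTheory GRing.Theory Num.Theory.
Import numFieldNormedType.Exports.

Local Open Scope classical_set_scope.
Local Open Scope ring_scope.

(** The first identity is pointwise: with [h = (a', c', z')], both sides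
    average [F] at the points
    [((a + j + a') / m, m * (c + c'), z + z' + c * a')] ([rho_Tm]).

    The second one is its adjoint.  The right translations [rho h] are unitary
    and [rho (hinv h)] inverts [rho h], so for [Y] in the Hilbert space and
    [h' = beta (1 / m) h], writing [T] for [Tm m],
    [<rho h Y, rho h (T* F)> = <Y, T* F> = <T Y, F>], while
    [<rho h Y, T* (rho h' F)> = <T (rho h Y), rho h' F>
     = <rho h' (T Y), rho h' F> = <T Y, F>];
    the middle step is the first identity for [h'], since
    [beta m (beta (1 / m) h) = h].  Every [X] is of the form [rho h Y], so
    [rho h (T* F)] and [T* (rho h' F)] have the same inner product with every
    vector, and they agree almost everywhere ([adjoint_rho]).

    Two analytic facts carry this.

    Unitarity ([L2H_inner_rho]) says that the integral over the unit cube of a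
    left H(Z)-invariant function [f] does not change under right translation.
    After Tonelli ([ge0_integral_unit_cube_hmulr]) this reduces to the same
    statement for 1-periodic functions on the line: [f] is 1-periodic in [z],
    so the inner integral over [z] absorbs the shear [z' + c * a']; the
    resulting function of [(a, c)] is 1-periodic in both variables.

    Uniqueness of the adjoint ([L2H_ae_eq]) is a statement on the whole group,
    while inner products only give equality almost everywhere on the unit
    cube.  But the set where two invariant functions differ is
    invariant, the integer left translates of the cube cover the group, and
    left translations preserve the Haar measure, so the set is negligible in
    the whole group ([negligible_left_invariant]). *)

(** * Functions of an integer variable *)

Lemma int_shift_invariant {T} (S : int -> T) :
  (forall k, S (k + 1) = S k) -> forall k, S k = S 0.
Proof.
move=> S1; have Spos (n : nat) : S n = S 0.
  by elim: n => // n <-; rewrite -addn1 PoszD S1.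
case=> // n; rewrite NegzE; elim: n.+1 => [|k IH]; first by rewrite oppr0.
by rewrite -IH -[LHS]S1; congr S; rewrite -addn1 PoszD opprD addrNK.
Qed.

(** Shifting the window by one exchanges [G k] for [G (k + n)]. *)
Lemma periodic_sum_shift {V : zmodType} (G : int -> V) (n : nat) (k : int) :
  (forall i, G (i + n%:Z) = G i) ->
  \sum_(0 <= j < n) G (k + j%:Z) = \sum_(0 <= j < n) G j%:Z.
Proof.
move=> Gn; rewrite (int_shift_invariant (fun k => \sum_(0 <= j < n) G (k + j%:Z))).
  by apply: eq_bigr => j _; rewrite add0r.
move=> {}k; apply: (addIr (G k)).
transitivity (\sum_(0 <= j < n.+1) G (k + j%:Z)).
  rewrite big_nat_recl//= addr0 addrC; congr (_ + _).
  by apply: eq_bigr => j _; congr G; rewrite -addn1 PoszD; ring.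
by rewrite big_nat_recr//= Gn.
Qed.

(** * Periodic functions on the line *)

Section PeriodicFunctions.
Context {R : realType}.
Local Notation mu := (@lebesgue_measure R).
Local Open Scope ereal_scope.

Lemma measurable_shift (s : R) :
  measurable_fun setT (fun x : measurableTypeR R => (x + s)%R : measurableTypeR R).
Proof. exact: measurable_funD. Qed.

(** A measure that agrees with Lebesgue measure on the intervals ]a, b] is
    Lebesgue measure. *)
Lemma lebesgue_measure_shift (s : R) (A : set (measurableTypeR R)) :
  measurable A ->
  pushforward mu (fun x => (x + s)%R : measurableTypeR R) A = mu A.
Proof.
move=> mA; apply/esym.
apply: (@lebesgue_measure_unique R
  (@pushforward _ _ _ _ R mu (fun x => (x + s)%R : measurableTypeR R))) => //.
- exact: measurable_shift.
move=> mshift _ [[a b]] _ <-; rewrite /pushforward.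
rewrite [RHS](_ : _ = mu `](a - s)%R, (b - s)%R]%classic); last first.
  congr (mu _); apply/seteqP; split => x /=;
    by rewrite !in_itv/= ltrBlDr lerBrDr.
rewrite !lebesgue_measure_itv/= !lte_fin ltrD2r; case: ifP => // _.
by rewrite -!EFinB; congr (_%:E); lra.
Qed.

Lemma ge0_integral_shift (s : R) (D : set R) (f : R -> \bar R) :
  measurable D -> measurable_fun setT f -> (forall x, 0 <= f x) ->
  \int[mu]_(x in [set x | D (x + s)%R]) f (x + s)%R = \int[mu]_(x in D) f x.
Proof.
move=> mD mf f0.
have := @ge0_integral_pushforward _ _ _ _ R
  _ (measurable_shift s) mu D f mD (measurable_funTS mf) (fun x _ => f0 x).
rewrite /comp/= => <-; apply: eq_measure_integral; first exact: measurable_shift.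
by move=> mshift B mB _; exact: lebesgue_measure_shift.
Qed.

Lemma ge0_integral_shiftT (s : R) (f : R -> \bar R) :
  measurable_fun setT f -> (forall x, 0 <= f x) ->
  \int[mu]_x f (x + s)%R = \int[mu]_x f x.
Proof. by move=> mf f0; exact: (ge0_integral_shift s setT). Qed.

Lemma periodic_int {T} (p : R -> T) (k : int) :
  (forall x, p (x + 1)%R = p x) -> forall x, p (x + k%:~R)%R = p x.
Proof.
move=> p1 x; rewrite (int_shift_invariant (fun k => p (x + k%:~R)%R)) ?addr0//.
by move=> i; rewrite intrD addrA p1.
Qed.

(** Translating the unit interval by [r] in [0, 1[ moves the piece [0, r[ past
    the other end, to [1, 1 + r[, where [p] takes the same values. *)
Lemma ge0_integral_periodic_shift (p : R -> \bar R) (s : R) :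
  measurable_fun setT p -> (forall x, 0 <= p x) ->
  (forall x, p (x + 1)%R = p x) ->
  \int[mu]_(x in `[0%R, 1%R]) p (x + s)%R = \int[mu]_(x in `[0%R, 1%R]) p x.
Proof.
move=> mp p0 p1.
(* By periodicity only the fractional part of [s] matters. *)
have [r [/andP[r0 r1] pr]] :
    exists r : R, (0 <= r < 1)%R /\ forall x, p (x + s)%R = p (x + r)%R.
  exists (s - (Num.floor s)%:~R)%R; split.
    by rewrite subr_ge0 ltrBlDl floor_le_tmp/= -intrD1 floorD1_gt.
  by move=> x; rewrite -[in LHS](subrK (Num.floor s)%:~R s) addrA (periodic_int p).
under eq_integral do rewrite pr.
(* Half-open intervals can be cut and glued without overlap. *)
rewrite -!integral_itv_bndo_bndc; last 2 first.
- exact: measurable_funTS.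
- by apply: measurable_funTS; exact: (measurableT_comp mp (measurable_shift r)).
transitivity (\int[mu]_(x in `[r, 1%R[ `|` `[1%R, (1 + r)%R[) p x).
  rewrite -(ge0_integral_shift r (_ `|` _))//; last exact: measurableU.
  congr (integral _ _ _); apply/seteqP; split => x/=; rewrite !in_itv/=.
    by move=> /andP[x0 x1]; case: (ltP (x + r)%R 1%R) => h; [left|right]; lra.
  by case; lra.
rewrite ge0_integral_setU//; last 2 first.
- exact: measurable_funTS.
- by apply/disj_setPS => x/=; rewrite !in_itv/=; lra.
rewrite [X in _ + X](_ : _ = \int[mu]_(x in `[0%R, r[) p x); last first.
  rewrite -(ge0_integral_shift 1%R `[1%R, (1 + r)%R[)//.
  rewrite [X in integral _ X _](_ : _ = `[0%R, r[%classic); last first.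
    by apply/seteqP; split => x/=; rewrite !in_itv/=; lra.
  by apply: eq_integral => x _; rewrite p1.
rewrite addeC -ge0_integral_setU//; last 2 first.
- exact: measurable_funTS.
- by apply/disj_setPS => x/=; rewrite !in_itv/=; lra.
congr (integral _ _ _); apply/seteqP; split => x/=; rewrite !in_itv/=.
  by case; lra.
by move=> /andP[x0 x1]; case: (ltP x r) => h; [left|right]; lra.
Qed.

End PeriodicFunctions.

(** * Tonelli on rectangles *)

Section RectangleFubini.
Local Open Scope ereal_scope.
Context d1 d2 (T1 : measurableType d1) (T2 : measurableType d2) (R : realType).
Variable m1 : {sigma_finite_measure set T1 -> \bar R}.
Variable m2 : {sigma_finite_measure set T2 -> \bar R}.
Variables (A : set T1) (B : set T2) (f : T1 * T2 -> \bar R).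
Hypotheses (mA : measurable A) (mB : measurable B).
Hypotheses (mf : measurable_fun setT f) (f0 : forall x, 0 <= f x).

Lemma measurable_fun_ge0_integral_section :
  measurable_fun setT (fun x => \int[m2]_(y in B) f (x, y)).
Proof.
under eq_fun do rewrite integral_mkcond.
have := @measurable_fun_fubini_tonelli_F _ _ _ _ R m2 (f \_ (setT `*` B)).
rewrite /fubini_F => /(_ _ _).
have mTB : measurable ([set: T1] `*` B) by exact: measurableX.
have -> : (fun x => \int[m2]_y (f \_ ([set: T1] `*` B)) (x, y))
        = (fun x => \int[m2]_y ((fun y => f (x, y)) \_ B) y).
  apply/funext => x; apply: eq_integral => y _; rewrite /patch.
  by congr (if _ then _ else _); apply/asboolP/asboolP => /= [[]|].
apply; last by move=> x; exact: erestrict_ge0.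
apply/(measurable_restrict _ mTB) => //.
exact: measurable_funTS.
Qed.

Lemma ge0_integral_setX :
  \int[m1 \x m2]_(p in A `*` B) f p =
  \int[m1]_(x in A) \int[m2]_(y in B) f (x, y).
Proof.
have mAB : measurable (A `*` B) by exact: measurableX.
rewrite integral_mkcond fubini_tonelli1; last 2 first.
- by apply/(measurable_restrict _ mAB) => //; exact: measurable_funTS.
- by move=> x; exact: erestrict_ge0.
rewrite [RHS]integral_mkcond; apply: eq_integral => x _; rewrite /fubini_F.
rewrite [in RHS]/patch; case: ifPn => [|] xA.
  rewrite [RHS]integral_mkcond; apply: eq_integral => y _; rewrite /patch.
  by congr (if _ then _ else _); apply/asboolP/asboolP => /= [[]|?] //;
    split => //; exact: set_mem.
rewrite integral0_eq// => y _; rewrite /patch ifF//; apply/negbTE.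
by apply: contra xA; rewrite !inE => -[].
Qed.

End RectangleFubini.

(** * The Heisenberg group and its Haar measure *)

Section PlaneMeasure.
Context {R : realType}.
Local Open Scope ereal_scope.
Local Notation mu := (@lebesgue_measure R).

(** The product of Lebesgue measures is named in order to attach a sigma-finite
    structure to it: it is the first factor of [haar], to which Tonelli's
    theorem is applied. *)
Definition plane_measure :
  set (measurableTypeR R * measurableTypeR R)%type -> \bar R := mu \x mu.

HB.instance Definition _ := Measure.on plane_measure.

Lemma plane_measure_sigma_finite : sigma_finite setT plane_measure.
Proof.
by case: (lebesgue_integral_fubini.measure_function_Measure_isSigmaFinite__to__measure_function_isSigmaFinite
  mu mu).
Qed.

HB.instance Definition _ := Measure_isSigmaFinite.Build _ _ _ plane_measure
  plane_measure_sigma_finite.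

Lemma haarE : haar = (plane_measure \x mu) :> {measure set (heis R) -> \bar R}.
Proof. by []. Qed.

End PlaneMeasure.

Section HeisenbergGroup.
Context {R : realType}.
Implicit Types (g h k : heis R) (t : R).

Definition hinv h : heis R :=
  let: (a, c, z) := h in (- a, - c, c * a - z).

Lemma hmulA g h k : hmul g (hmul h k) = hmul (hmul g h) k.
Proof.
move: g h k => [[a c] z] [[a1 c1] z1] [[a2 c2] z2] /=.
by congr (_, _, _); ring.
Qed.

Lemma hmulgK h g : hmul (hmul g h) (hinv h) = g.
Proof.
move: g h => [[a c] z] [[a1 c1] z1] /=.
by congr (_, _, _); ring.
Qed.

Lemma betaK t : t != 0 -> cancel (beta (1 / t)) (beta t).
Proof.
move=> t0 [[a c] z] /=; congr (_, _, _).
- by rewrite div1r invrK mulKf.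
- by rewrite div1r mulrA divff// mul1r.
Qed.

Lemma measurable_fun_triple d (T : measurableType d) (u v w : T -> R) :
  measurable_fun setT u -> measurable_fun setT v -> measurable_fun setT w ->
  measurable_fun setT (fun x => (u x, v x, w x) : heis R).
Proof.
by move=> mu mv mw; apply: measurable_fun_pair => //; exact: measurable_fun_pair.
Qed.

Lemma measurable_fun_coord :
  [/\ measurable_fun setT (fun g => g.1.1 : R),
      measurable_fun setT (fun g => g.1.2 : R)
    & measurable_fun setT (fun g => g.2 : R)].
Proof.
split.
- exact: (measurableT_comp measurable_fst measurable_fst).
- exact: (measurableT_comp measurable_snd measurable_fst).
- exact: measurable_snd.
Qed.

Lemma measurable_hmul d (T : measurableType d) (u v : T -> heis R) :
  measurable_fun setT u -> measurable_fun setT v ->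
  measurable_fun setT (fun x => hmul (u x) (v x)).
Proof.
move=> mu mv; have [m1 m2 m3] := measurable_fun_coord.
rewrite (_ : (fun x => _) = fun x =>
  ((u x).1.1 + (v x).1.1, (u x).1.2 + (v x).1.2,
   (u x).2 + (v x).2 + (u x).1.2 * (v x).1.1)); last first.
  by apply/funext => x; case: (u x) => -[? ?] ?; case: (v x) => -[? ?] ?.
have mc1 (w : T -> heis R) : measurable_fun setT w ->
    measurable_fun setT (fun x : T => (w x).1.1).
  by move=> mw; exact: (measurableT_comp m1 mw).
have mc2 (w : T -> heis R) : measurable_fun setT w ->
    measurable_fun setT (fun x : T => (w x).1.2).
  by move=> mw; exact: (measurableT_comp m2 mw).
have mc3 (w : T -> heis R) : measurable_fun setT w ->
    measurable_fun setT (fun x : T => (w x).2).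
  by move=> mw; exact: (measurableT_comp m3 mw).
apply: measurable_fun_triple.
- by apply: measurable_funD; exact: mc1.
- by apply: measurable_funD; exact: mc2.
- apply: measurable_funD; first by apply: measurable_funD; exact: mc3.
  by apply: measurable_funM; [exact: mc2|exact: mc1].
Qed.

Lemma measurable_hmulr h : measurable_fun setT (fun g => hmul g h).
Proof. exact: measurable_hmul. Qed.

Lemma measurable_hmull h : measurable_fun setT (hmul h).
Proof. exact: measurable_hmul. Qed.

Lemma measurable_unit_cube : measurable (@unit_cube R).
Proof. by apply: measurableX => //; exact: measurableX. Qed.

(** Invariance under H(Z), for functions with values in any type: it is applied
    to elements of [L2H], to their components and to extended real integrands. *)
Definition left_invariant {V} (f : heis R -> V) :=
  forall gamma g, heisZ gamma -> f (hmul gamma g) = f g.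

Local Open Scope ereal_scope.
Local Notation mu := (@lebesgue_measure R).
Local Notation I01 := `[0%R, 1%R]%classic.

Lemma ge0_integral_unit_cube (f : heis R -> \bar R) :
  measurable_fun setT f -> (forall g, 0 <= f g) ->
  \int[haar]_(g in unit_cube) f g =
  \int[mu]_(a in I01) \int[mu]_(c in I01) \int[mu]_(z in I01) f (a, c, z).
Proof.
move=> mf f0; rewrite /unit_cube haarE.
have mII : measurable
    (I01 `*` I01 : set (measurableTypeR R * measurableTypeR R)%type)
  by exact: measurableX.
rewrite ge0_integral_setX// /plane_measure ge0_integral_setX//.
- exact: measurable_fun_ge0_integral_section.
- by move=> x; exact: integral_ge0.
Qed.

(** Integrating [z] out first matters: [f] is 1-periodic in [z] and in [a], but
    in [c] only up to the shear [(a, c + 1, z + a)], which disappears once [z]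
    is integrated over a period. *)
Lemma ge0_integral_unit_cube_hmulr (f : heis R -> \bar R) h :
  measurable_fun setT f -> (forall g, 0 <= f g) -> left_invariant f ->
  \int[haar]_(g in unit_cube) f (hmul g h) =
  \int[haar]_(g in unit_cube) f g.
Proof.
move=> mf f0 finv.
have mfh : measurable_fun setT (fun g => f (hmul g h)).
  exact: (measurableT_comp mf (measurable_hmulr h)).
rewrite (ge0_integral_unit_cube _ mf f0).
rewrite (ge0_integral_unit_cube _ mfh (fun g => f0 (hmul g h))).
case: h {mfh} => -[a' c'] z' /=.
have fz a c z : f (a, c, (z + 1)%R) = f (a, c, z).
  rewrite -[RHS](finv (0, 0, 1)%R); last by exists 0%Z, 0%Z, 1%Z.
  by congr (f (_, _, _)); rewrite /=; ring.
have fc a c z : f (a, (c + 1)%R, (z + a)%R) = f (a, c, z).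
  rewrite -[RHS](finv (0, 1, 0)%R); last by exists 0%Z, 1%Z, 0%Z.
  by congr (f (_, _, _)); rewrite /=; ring.
have fa a c z : f ((a + 1)%R, c, z) = f (a, c, z).
  rewrite -[RHS](finv (1, 0, 0)%R); last by exists 1%Z, 0%Z, 0%Z.
  by congr (f (_, _, _)); rewrite /=; ring.
have mfz a c : measurable_fun setT (fun z => f (a, c, z)).
  by apply: measurableT_comp => //; exact: measurable_fun_triple.
pose phi (ac : measurableTypeR R * measurableTypeR R) :=
  \int[mu]_(z in I01) f (ac.1, ac.2, z).
have mphi : measurable_fun setT phi.
  have := measurable_fun_ge0_integral_section _ _ _ _ R mu I01 f.
  move=> /(_ _ mf f0) H; rewrite (_ : phi = fun x => \int[mu]_(z in I01) f (x, z)).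
    exact: H.
  by apply/funext => -[].
have phi0 ac : 0 <= phi ac by exact: integral_ge0.
have phia a c : phi ((a + 1)%R, c) = phi (a, c).
  by apply: eq_integral => z _ /=.
have phic a c : phi (a, (c + 1)%R) = phi (a, c).
  rewrite /phi/= -(ge0_integral_periodic_shift _ a (mfz a (c + 1)%R)
    (fun=> f0 _) (fz a (c + 1)%R)).
  by apply: eq_integral => z _.
have mphic a : measurable_fun setT (fun c => phi (a, c)).
  by apply: measurableT_comp => //; exact: measurable_fun_pair.
pose psi (a : R) := \int[mu]_(c in I01) phi (a, c).
have mpsi : measurable_fun setT psi.
  by apply: measurable_fun_ge0_integral_section.
transitivity (\int[mu]_(a in I01) psi (a + a')%R).
  apply: eq_integral => a _.
  rewrite -[RHS](ge0_integral_periodic_shift _ c' (mphic (a + a')%R)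
    (fun=> phi0 _) (phic (a + a')%R)).
  apply: eq_integral => c _; rewrite /phi/=.
  rewrite -(ge0_integral_periodic_shift _ (z' + c * a')%R
    (mfz (a + a')%R (c + c')%R) (fun=> f0 _) (fz _ _)).
  by apply: eq_integral => z _; rewrite addrA.
rewrite ge0_integral_periodic_shift//.
- by move=> a; exact: integral_ge0.
- by move=> a; apply: eq_integral => c _.
Qed.

(** For fixed [(a, c)], left translation acts on [z] as a translation, so
    Tonelli reduces the claim to the line. *)
Lemma ge0_integral_haar_hmull (f : heis R -> \bar R) h :
  measurable_fun setT f -> (forall g, 0 <= f g) ->
  \int[haar]_g f (hmul h g) = \int[haar]_g f g.
Proof.
move=> mf f0.
have mfh : measurable_fun setT (fun g => f (hmul h g)).
  by apply: measurableT_comp => //; exact: measurable_hmull.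
rewrite haarE (fubini_tonelli1 f mf f0).
rewrite (fubini_tonelli1 _ mfh (fun g => f0 (hmul h g))) /fubini_F.
pose phi (ac : measurableTypeR R * measurableTypeR R) :=
  \int[mu]_z f (ac, z).
have mphi : measurable_fun setT phi by exact: measurable_fun_fubini_tonelli_F.
have phi0 ac : 0 <= phi ac by exact: integral_ge0.
case: h mfh => -[k l] n mfh.
have mkl : measurable_fun setT
    (fun ac : measurableTypeR R * measurableTypeR R =>
      ((ac.1 + k)%R, (ac.2 + l)%R)
      : (measurableTypeR R * measurableTypeR R)%type).
  by apply: measurable_fun_pair; apply: measurable_funD.
transitivity (\int[mu \x mu]_ac phi ((ac.1 + k)%R, (ac.2 + l)%R)).
  apply: eq_integral => -[a c] _ /=; rewrite /phi.
  rewrite -[RHS](ge0_integral_shiftT (n + l * a)%R); last 2 first.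
  - apply: measurableT_comp => //; exact: measurable_fun_triple.
  - by [].
  by apply: eq_integral => z _; congr (f (_, _, _)); ring.
rewrite /plane_measure (fubini_tonelli1 _ mphi phi0).
rewrite (fubini_tonelli1 _ (measurableT_comp mphi mkl) (fun=> phi0 _)).
rewrite /fubini_F -[RHS](ge0_integral_shiftT k).
- apply: eq_integral => a _ /=.
  apply: (ge0_integral_shiftT l (fun c => phi ((a + k)%R, c))) => //.
  by apply: measurableT_comp => //; exact: measurable_fun_pair.
- exact: measurable_fun_fubini_tonelli_F.
- by move=> a; exact: integral_ge0.
Qed.

(** The unit cube meets every orbit of H(Z), so [N] is covered by countably many
    left translates of its intersection with the cube. *)
Lemma negligible_left_invariant (N : set (heis R)) :
  measurable N -> (forall gamma g, heisZ gamma -> N g -> N (hmul gamma g)) ->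
  haar (N `&` unit_cube) = 0 -> haar.-negligible N.
Proof.
move=> mN Ninv N0.
pose B := N `&` unit_cube.
have mB : measurable B by apply: measurableI => //; exact: measurable_unit_cube.
(* The translate of [B] by the inverse of the integer point [i]. *)
pose P (i : int * int * int) : set (heis R) :=
  [set g | B (hmul (i.1.1%:~R, i.1.2%:~R, i.2%:~R)%R g)].
have mP i : measurable (P i).
  by rewrite -[P i]setTI; exact: measurable_hmull.
have P0 i : haar.-negligible (P i).
  apply/negligibleP => //; apply: etrans N0.
  have haar_indic (A : set (heis R)) : measurable A ->
      haar A = \int[haar]_g (\1_A g)%:E.
    by move=> mA; rewrite integral_indic// setIT.
  have mindic : measurable_fun setT (fun g => (\1_B g)%:E : \bar R).
    by apply/measurable_EFinP; exact: measurable_indic.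
  rewrite [RHS](haar_indic B mB).
  rewrite -(ge0_integral_haar_hmull _ (i.1.1%:~R, i.1.2%:~R, i.2%:~R)%R mindic)//.
  exact: (haar_indic (P i)).
apply: (@negligibleS _ _ _ _ (\bigcup_n
    if unpickle n is Some i then P i else set0)); last first.
  by apply: negligible_bigcup => n; case: unpickle => // *; exact: negligible_set0.
move=> [[a c] z] Ng.
(* Make [a] and [c] fractional first; multiplying by an element with second
   coordinate [l] adds [l * a] to [z], which [n] has to take into account. *)
pose k := (- Num.floor a)%R; pose l := (- Num.floor c)%R.
pose n := (- Num.floor (z + l%:~R * a))%R.
exists (pickle (k, l, n)); first exact: I.
rewrite pickleK.
have floor_itv (x : R) : (0 <= (- Num.floor x)%:~R + x <= 1)%R.
  have := floor_le_tmp x; have := floorD1_gt x.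
  by rewrite mulrNz intrD1; lra.
split; first by apply: Ninv => //; exists k, l, n.
split; first by split; rewrite /= in_itv/= floor_itv.
by rewrite /= in_itv/= -addrA floor_itv.
Qed.

End HeisenbergGroup.

(** * The Hilbert space and its right translations *)

Section ComplexFunctions.
Context {R : realType}.
Implicit Types (F G X : heis R -> R[i]) (h : heis R).

Lemma sqr_normc (x : R[i]) :
  (Normc.normc x) ^+ 2 = complex.Re x ^+ 2 + complex.Im x ^+ 2.
Proof. by case: x => a b /=; rewrite sqr_sqrtr// addr_ge0// sqr_ge0. Qed.

Lemma measurable_sqr_normc F : cmeasurable F ->
  measurable_fun setT (fun g => Normc.normc (F g) ^+ 2).
Proof.
move=> [mRe mIm]; under eq_fun do rewrite sqr_normc.
by apply: measurable_funD; exact: measurable_funX.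
Qed.

Lemma cmeasurable_comp F (u : heis R -> heis R) :
  cmeasurable F -> measurable_fun setT u -> cmeasurable (F \o u).
Proof. by move=> [mRe mIm] mu; split;
  [exact: (measurableT_comp mRe mu)|exact: (measurableT_comp mIm mu)]. Qed.

Lemma cmeasurableD F G : cmeasurable F -> cmeasurable G ->
  cmeasurable (fun g => F g + G g).
Proof.
move=> [mF mF'] [mG mG']; split.
- rewrite (_ : (fun g => _) = (fun g => complex.Re (F g) + complex.Re (G g))).
    exact: measurable_funD.
  by apply/funext => g; case: (F g) (G g) => ? ? [].
- rewrite (_ : (fun g => _) = (fun g => complex.Im (F g) + complex.Im (G g))).
    exact: measurable_funD.
  by apply/funext => g; case: (F g) (G g) => ? ? [].
Qed.

Lemma cmeasurableM F G : cmeasurable F -> cmeasurable G ->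
  cmeasurable (fun g => F g * G g).
Proof.
move=> [mF mF'] [mG mG']; split.
- rewrite (_ : (fun g => _) = (fun g => complex.Re (F g) * complex.Re (G g)
                                      - complex.Im (F g) * complex.Im (G g))).
    by apply: measurable_funB; exact: measurable_funM.
  by apply/funext => g; case: (F g) (G g) => ? ? [].
- rewrite (_ : (fun g => _) = (fun g => complex.Re (F g) * complex.Im (G g)
                                      + complex.Im (F g) * complex.Re (G g))).
    by apply: measurable_funD; exact: measurable_funM.
  by apply/funext => g; case: (F g) (G g) => ? ? [].
Qed.

Lemma cmeasurable_cst (x : R[i]) : cmeasurable (fun=> x).
Proof. by split; exact: measurable_cst. Qed.

Lemma cmeasurable_conjc F : cmeasurable F -> cmeasurable (fun g => conjc (F g)).
Proof.
move=> [mRe mIm]; split.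
- rewrite (_ : (fun g => _) = (fun g => complex.Re (F g)))//.
  by apply/funext => g; case: (F g).
- rewrite (_ : (fun g => _) = (fun g => - complex.Im (F g))).
    exact: measurable_funN.
  by apply/funext => g; case: (F g).
Qed.

Lemma cmeasurable_sum (I : Type) (s : seq I) (F : I -> heis R -> R[i]) :
  (forall i, cmeasurable (F i)) -> cmeasurable (fun g => \sum_(i <- s) F i g).
Proof.
move=> mF; elim: s => [|i s IH].
  by under [X in cmeasurable X]eq_fun do rewrite big_nil; exact: cmeasurable_cst.
under [X in cmeasurable X]eq_fun do rewrite big_cons.
exact: cmeasurableD.
Qed.

Lemma left_invariant_rho {V} h (f : heis R -> V) :
  left_invariant f -> left_invariant (fun g => f (hmul g h)).
Proof. by move=> fI gamma g Zg; rewrite -hmulA fI. Qed.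

(** The integrals of the positive and of the negative part are preserved
    separately. *)
Lemma Rintegral_unit_cube_hmulr (f : heis R -> R) h :
  measurable_fun setT f -> left_invariant f ->
  \int[haar]_(g in unit_cube) f (hmul g h) = \int[haar]_(g in unit_cube) f g.
Proof.
move=> mf fI; rewrite /Rintegral; congr fine.
have mf' : measurable_fun setT (EFin \o f) by exact/measurable_EFinP.
rewrite [LHS]integralE [RHS]integralE; congr (_ - _)%E.
- rewrite -(ge0_integral_unit_cube_hmulr _ h (measurable_funepos mf'))//.
  + by apply: eq_integral => g _; rewrite !funeposE.
  + by move=> gamma g Zg; rewrite !funeposE /= fI.
- rewrite -(ge0_integral_unit_cube_hmulr _ h (measurable_funeneg mf'))//.
  + by apply: eq_integral => g _; rewrite !funenegE.
  + by move=> gamma g Zg; rewrite !funenegE /= fI.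
Qed.

Lemma L2H_inner_rho F G h :
  cmeasurable F -> left_invariant F -> cmeasurable G -> left_invariant G ->
  L2H_inner (rho h F) (rho h G) = L2H_inner F G.
Proof.
move=> mF FI mG GI; rewrite /L2H_inner /cintegral.
have [mRe mIm] := cmeasurableM _ _ mF (cmeasurable_conjc _ mG).
by congr (_ +i* _)%C; [apply: (Rintegral_unit_cube_hmulr _ h mRe)
                      |apply: (Rintegral_unit_cube_hmulr _ h mIm)];
  move=> gamma g Zg /=; rewrite FI// GI.
Qed.

Lemma L2H_rho F h : L2H F -> L2H (rho h F).
Proof.
move=> [mF FI Foo]; split.
- exact: (cmeasurable_comp F _ mF (measurable_hmulr h)).
- exact: left_invariant_rho.
- rewrite (ge0_integral_unit_cube_hmulr
    (fun g => ((Normc.normc (F g)) ^+ 2)%:E) h)//.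
  + by apply/measurable_EFinP; exact: measurable_sqr_normc.
  + by move=> g; rewrite lee_fin sqr_ge0.
  + by move=> gamma g Zg; rewrite FI.
Qed.

Lemma Re_mul_conjc (x y : R[i]) : complex.Re (x * conjc y) =
  complex.Re x * complex.Re y + complex.Im x * complex.Im y.
Proof. by case: x y => a b [c d] /=; ring. Qed.

Lemma integrable_sqr_normc F : L2H F ->
  haar.-integrable unit_cube (EFin \o (fun g => Normc.normc (F g) ^+ 2)).
Proof.
move=> [mF _ Foo]; apply/integrableP; split.
  apply: measurable_funTS; apply/measurable_EFinP.
  exact: measurable_sqr_normc.
by under eq_integral do rewrite /= ger0_norm ?sqr_ge0//.
Qed.

(** [|Re (F conj G)|] is at most [|F|^2 + |G|^2]. *)
Lemma integrable_Re_mul_conjc F G : L2H F -> L2H G ->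
  haar.-integrable unit_cube (EFin \o (fun g => complex.Re (F g * conjc (G g)))).
Proof.
move=> LF LG; have mcube := @measurable_unit_cube R.
have /(integrableD mcube (integrable_sqr_normc _ LF)) :=
  integrable_sqr_normc _ LG.
apply: le_integrable => //.
  case: LF LG => mF _ _ [mG _ _]; apply: measurable_funTS.
  by apply/measurable_EFinP; have [] := cmeasurableM _ _ mF (cmeasurable_conjc _ mG).
move=> g _ /=; rewrite lee_fin Re_mul_conjc !sqr_normc.
rewrite [leRHS]ger0_norm ?addr_ge0// ?sqr_ge0//.
move: (complex.Re (F g)) (complex.Im (F g)) => a b.
move: (complex.Re (G g)) (complex.Im (G g)) => c d.
have := (sqr_ge0 (a + c), sqr_ge0 (b + d), sqr_ge0 (a - c), sqr_ge0 (b - d)).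
move=> [[[acD bdD] acB] bdB].
have := (sqr_ge0 a, sqr_ge0 b, sqr_ge0 c, sqr_ge0 d) => -[[[a0 b0] c0] d0].
by rewrite ler_norml; apply/andP; split; nra.
Qed.

(** Testing against [X = F] and [X = G] is enough:
    [|F - G|^2 = <F, F> - <F, G> - <G, F> + <G, G>] integrates to 0. *)
Lemma L2H_ae_eq F G : L2H F -> L2H G ->
  (forall X, L2H X -> L2H_inner X F = L2H_inner X G) -> F = G %[ae haar].
Proof.
move=> LF LG FG; have mcube := @measurable_unit_cube R.
have [[mF FI _] [mG GI _]] := (LF, LG).
pose D g := F g - G g.
have mD : cmeasurable D.
  have := cmeasurableD _ _ mF (cmeasurableM _ _ (cmeasurable_cst (-1)) mG).
  by congr cmeasurable; apply/funext => g; rewrite /D mulN1r.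
pose N := [set g | Normc.normc (D g) ^+ 2 != 0].
have mN : measurable N.
  rewrite (_ : N = (fun g => Normc.normc (D g) ^+ 2) @^-1` (~` [set 0])); last first.
    by apply/seteqP; split => g /= /eqP.
  rewrite -[X in measurable X]setTI; apply: measurable_sqr_normc => //.
  exact: measurableC.
have int0 : (\int[haar]_(g in unit_cube) ((Normc.normc (D g)) ^+ 2)%:E = 0)%E.
  have iFF := integrable_Re_mul_conjc _ _ LF LF.
  have iFG := integrable_Re_mul_conjc _ _ LF LG.
  have iGF := integrable_Re_mul_conjc _ _ LG LF.
  have iGG := integrable_Re_mul_conjc _ _ LG LG.
  have iL := integrableB mcube iFF iFG.
  have iR := integrableB mcube iGF iGG.
  transitivity (\int[haar]_(g in unit_cube)
    ((complex.Re (F g * conjc (F g)) - complex.Re (F g * conjc (G g)))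
   - (complex.Re (G g * conjc (F g)) - complex.Re (G g * conjc (G g))))%:E)%E.
    apply: eq_integral => g _; congr EFin.
    rewrite !Re_mul_conjc sqr_normc /D; case: (F g) (G g) => a b [c d] /=.
    by ring.
  rewrite integralB_EFin// !integralB_EFin//.
  have E X Y : L2H X -> L2H Y ->
    (\int[haar]_(g in unit_cube) (complex.Re (X g * conjc (Y g)))%:E
     = (complex.Re (L2H_inner X Y))%:E)%E.
    move=> LX LY; rewrite /L2H_inner /cintegral /= /Rintegral fineK//.
    exact: integrable_fin_num (integrable_Re_mul_conjc _ _ LX LY).
  by rewrite !E// !FG// !subee.
have N0 : haar (N `&` unit_cube) = 0.
  apply/negligibleP; first exact: measurableI.
  have mn : measurable_fun unit_cube (fun g => (Normc.normc (D g) ^+ 2)%:E).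
    apply: measurable_funTS; apply/measurable_EFinP.
    exact: measurable_sqr_normc.
  have abs0 :
      (\int[haar]_(g in unit_cube) `|((Normc.normc (D g)) ^+ 2)%:E| = 0)%E.
    by rewrite -int0; apply: eq_integral => g _; rewrite /= ger0_norm ?sqr_ge0.
  have [A [mA A0 DA]] := (ae_eq_integral_abs haar mcube mn).1 abs0.
  exists A; split => // g [Ng cg]; apply: DA => /= /(_ cg) [Dg0].
  by rewrite /N /= Dg0 eqxx in Ng.
have [//|A [mA A0 NA]] := negligible_left_invariant _ mN _ N0.
  by move=> gamma g Zg; rewrite /N/= /D FI// GI.
exists A; split => // g /= FGg; apply: NA => /=.
rewrite /N /= sqrf_eq0; apply: contra_notN FGg => /eqP /Normc.eq0_normc.
by move=> /subr0_eq.
Qed.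

End ComplexFunctions.

(** * Averaging operators and their adjoints *)

Section Averaging.
Context {R : realType} (m : int) (m0 : m != 0).
Implicit Types (F G X : heis R -> R[i]) (h : heis R).

Let mR0 : m%:~R != 0 :> R.
Proof. by rewrite intr_eq0. Qed.

Lemma rho_Tm h F : rho h (Tm m F) = Tm m (rho (beta m%:~R h) F).
Proof.
apply/funext => -[[a c] z]; case: h => -[a' c'] z'; rewrite /rho /Tm /=.
congr (_ * _); apply: eq_bigr => j _; congr (F (_, _, _)).
- by field.
- by ring.
- by field.
Qed.

Lemma cmeasurable_Tm F : cmeasurable F -> cmeasurable (Tm m F).
Proof.
move=> mF.
pose u j (g : heis R) : heis R :=
  ((g.1.1 + j%:R) / m%:~R, m%:~R * g.1.2, g.2).
have -> : Tm m F = fun g =>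
    (`|m|%N%:R)^-1 * \sum_(0 <= j < `|m|%N) (F \o u j) g.
  by apply/funext => -[[a c] z].
apply: cmeasurableM; first exact: cmeasurable_cst.
apply: cmeasurable_sum => j; apply: (cmeasurable_comp F (u j) mF).
have [m1 m2 m3] := @measurable_fun_coord R.
apply: measurable_fun_triple => //.
- by apply: measurable_funM => //; exact: measurable_funD.
- exact: measurable_funM.
Qed.

(** The integer point [(k, l, n)] moves the arguments of the average to those of
    index [k + j], up to the integer point [(0, m * l, n - l * (k + j))]; the
    shift by [k] is harmless because the summand has period [|m|] in [j]. *)
Lemma left_invariant_Tm F : left_invariant F -> left_invariant (Tm m F).
Proof.
move=> FI _ [[a c] z] [k [l [n ->]]]; rewrite /Tm /=; congr (_ * _).
pose G (i : int) := F ((a + i%:~R) / m%:~R, m%:~R * c, z).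
transitivity (\sum_(0 <= j < `|m|%N) G (k + j%:Z)).
  apply: eq_bigr => j _; rewrite /G.
  rewrite -[RHS](FI (0, (m * l)%:~R, (n - l * (k + j%:Z))%:~R)); last first.
    by exists 0, (m * l), (n - l * (k + j%:Z)).
  congr (F (_, _, _)) => /=.
  - by rewrite intrD; field.
  - by rewrite intrM; ring.
  - by rewrite intrB !intrM intrD; field.
rewrite periodic_sum_shift// => i; rewrite /G.
(* [|m| / m] is the sign of [m], an integer. *)
rewrite -[RHS](FI ((sgz m)%:~R, 0, 0)); last by exists (sgz m), 0, 0.
rewrite abszEsg intrD intrM.
by congr (F (_, _, _)) => /=; field.
Qed.

(** Both sides have inner product [<Tm m Y, F>] with [rho h Y]. *)
Lemma adjoint_rho Tstar h F : is_adjoint (Tm m) Tstar -> L2H F ->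
  rho h (Tstar F) = Tstar (rho (beta (1 / m%:~R) h) F) %[ae haar].
Proof.
move=> [TstarL adj] LF; set h' := beta _ h.
have LF' := L2H_rho _ h' LF; have [mF FI _] := LF.
apply: L2H_ae_eq; [exact/L2H_rho/TstarL|exact: TstarL|] => X LX.
pose Y := rho (hinv h) X.
have LY : L2H Y by exact: L2H_rho.
have XE : X = rho h Y.
  by apply/funext => g; rewrite /Y /rho hmulgK.
have [mX XI _] := LX; have [mY YI _] := LY.
have [mTF TFI _] := TstarL _ LF.
rewrite {1}XE L2H_inner_rho// -!adj// XE.
have -> : Tm m (rho h Y) = rho h' (Tm m Y) by rewrite rho_Tm betaK.
by rewrite L2H_inner_rho//; [exact: cmeasurable_Tm|exact: left_invariant_Tm].
Qed.

End Averaging.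

Theorem theorem4p4 (R : realType) (m : int) (hm : m != 0) :
  (forall (h : heis R) (F : heis R -> R[i]), L2H F ->
     (rho h \o Tm m) F = (Tm m \o rho (beta m%:~R h)) F %[ae haar]) /\
  (forall Tstar : (heis R -> R[i]) -> (heis R -> R[i]),
     is_adjoint (Tm m) Tstar ->
     forall (h : heis R) (F : heis R -> R[i]), L2H F ->
     (rho h \o Tstar) F = (Tstar \o rho (beta (1 / m%:~R) h)) F %[ae haar]).
Proof.
split=> [h F _|Tstar adj h F LF]; first by rewrite /= rho_Tm//; exact: ae_eq_refl.
exact: (adjoint_rho m hm Tstar h F adj LF).
Qed.
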